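(* Let $x^0\in\mathcal S\cap\Omega$ and $\epsilon'>0$, and suppose that the sequence of iterates $(l^k,t^k,y^k,x^{k+1})$, $k=0,1,2,\dots$, is generated by the algorithm PS-DCA. Assume that the parameter sequence $\{\lambda_k\}$ has positive upper and lower bounds (there are constants $0<\underline\lambda\le\overline\lambda<\infty$ with $\underline\lambda\le\lambda_k\le\overline\lambda$ for all $k$) and that $\{\rho_k\}$ has a positive lower bound. Then $\{l^k\}$ and $\{t^k\}$ are bounded. Moreover, as $k\to\infty$, $$\|l^k-x^k\|\to 0,\qquad \|x^k-x^{k+1}\|\to 0.$$
   Context: Standing assumptions: $T,B:\mathbb R^n\to\mathbb R$ are (finite-valued) convex functions with $T(\alpha x)=\alpha T(x)\ge 0$ and $B(\alpha x)=\alpha B(x)\ge 0$ for all $\alpha\ge 0$, $x\in\mathbb R^n$; moreover $\{x\in\mathbb R^n: B(x)=0\}\cap\{x\in\mathbb R^n: T(x)=0\}=\{0\}$ and $\Omega:=\{x\in\mathbb R^n: B(x)\ne 0\}$ is nonempty. For $x\in\Omega$, $E(x):=T(x)/B(x)$. $\|\cdot\|$ is the Euclidean norm, $\mathcal S:=\{x\in\mathbb R^n:\|x\|=1\}$, $\partial$ denotes the convex subdifferential, and $\mathrm{prox}_f(x):=\mathrm{argmin}_{y\in\mathbb R^n}\bigl(f(y)+\tfrac12\|x-y\|^2\bigr)$ for a proper lower semicontinuous convex $f$. Algorithm PS-DCA. Input: an initial point $x^0\in\mathcal S\cap\Omega$ and an acceptance parameter $\epsilon'>0$. For $k=0,1,2,\dots$: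 (i) take $\lambda_k>0$ and any $v^k\in\partial B(x^k)$, and set $l^k=\mathrm{prox}_{\lambda_kT}(x^k+\lambda_kE(x^k)v^k)$; (ii) take $\rho_k>0$ and any $w^k\in\partial B(0)$, and set $t^k=\mathrm{prox}_{T/\rho_k}\bigl(\tfrac{E(l^k)}{\rho_k}w^k\bigr)$; (iii) with $\tilde g^k(x)=T(x)+\tfrac{\rho_k}{2}\|x\|^2$ and $\tilde h^k(x)=E(l^k)B(x)+\tfrac{\rho_k}{2}\|x\|^2$, if $(\tilde g^k-\tilde h^k)(t^k)<-\epsilon'$ set $y^k=t^k$; otherwise set $y^k=l^k$; (iv) set $x^{k+1}=y^k/\|y^k\|$. (The iterates are well defined: $l^k\in\Omega$ and $x^{k+1}\in\mathcal S\cap\Omega$ for all $k$.) *)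

(* Defs.v *)
(* MathComp / MathComp-Analysis *)
From HB Require Import structures.
From mathcomp Require Import all_boot all_order all_algebra.
From mathcomp Require Import all_classical all_reals all_analysis.

Set Implicit Arguments.
Unset Strict Implicit.
Unset Printing Implicit Defensive.

Import Order.TTheory GRing.Theory Num.Theory.
Import numFieldNormedType.Exports.

Local Open Scope classical_set_scope.
Local Open Scope ring_scope.

Section EuclideanSpace.
Context {R : realType} {n : nat}.
Implicit Types (f : 'rV[R]_n -> R) (x y v : 'rV[R]_n).

Definition dot x y : R := \sum_(i < n) x 0 i * y 0 i.

(* The library norm `|x| on 'rV[R]_n is the sup norm, hence this definition. *)
Definition enorm x : R := Num.sqrt (dot x x).

Definition sphere : set 'rV[R]_n := [set x | enorm x = 1].

Definition subdiff f x : set 'rV[R]_n :=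
  [set v | forall y, f x + dot v (y - x) <= f y].

Definition argmin f : set 'rV[R]_n := [set p | forall y, f p <= f y].

(* For convex f the objective is strictly convex, so this set has at most one
   point, and [prox f x p] reads "p = prox_f(x)". *)
Definition prox f x : set 'rV[R]_n :=
  argmin (fun y => f y + 2^-1 * enorm (x - y) ^+ 2).

Definition pos_homogeneous f : Prop :=
  forall (a : R) x, 0 <= a -> f (a *: x) = a * f x /\ 0 <= a * f x.

End EuclideanSpace.

Section PSDCA.
Context {R : realType} {n : nat}.
Variables T B : 'rV[R]_n -> R.

Definition Omega : set 'rV[R]_n := [set x | B x != 0].

(* Meaningful on [Omega] only; the value outside [Omega] is 0, as x / 0 = 0. *)
Definition E (x : 'rV[R]_n) : R := T x / B x.

Definition gtilde (rho : R) (x : 'rV[R]_n) : R :=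
  T x + rho / 2 * enorm x ^+ 2.

(* [l] is the point l^k of the current iteration. *)
Definition htilde (rho : R) (l x : 'rV[R]_n) : R :=
  E l * B x + rho / 2 * enorm x ^+ 2.

(* The given sequences form a run of PS-DCA with acceptance parameter [eps].
   That [l k] lies in [Omega] and [x k] in [sphere `&` Omega] for all [k] is a
   consequence and is not required here. *)
Record PS_DCA (eps : R) (lambda rho : nat -> R)
    (v w x l t y : nat -> 'rV[R]_n) : Prop := {
  psdca_eps_gt0 : 0 < eps;
  psdca_init : x 0%N \in sphere `&` Omega;
  psdca_lambda_gt0 : forall k, 0 < lambda k;
  psdca_v : forall k, subdiff B (x k) (v k);
  psdca_l : forall k,
    prox (fun z => lambda k * T z)
      (x k + (lambda k * E (x k)) *: v k) (l k);
  psdca_rho_gt0 : forall k, 0 < rho k;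
  psdca_w : forall k, subdiff B 0 (w k);
  psdca_t : forall k,
    prox (fun z => T z / rho k) ((E (l k) / rho k) *: w k) (t k);
  psdca_y : forall k,
    y k = if gtilde (rho k) (t k) - htilde (rho k) (l k) (t k) < - eps
          then t k else l k;
  psdca_x : forall k, x k.+1 = (enorm (y k))^-1 *: y k
}.

End PSDCA.

(* Main.v *)
Require Import Defs.
From HB Require Import structures.
From mathcomp Require Import all_boot all_order all_algebra.
From mathcomp Require Import all_classical all_reals all_analysis.
From mathcomp Require Import ring lra.

(** [T] and [B] are sublinear, so [u] is a subgradient of [T] at [p] iff
    [<u, z> <= T z] for all [z], with equality at [p]. The optimality
    conditions of the two proximal steps then give
      [|l - x|^2 + lambda T(l) <= lambda E(x) B(l)],
      [|t| <= E(l) C / rho], where [B <= C |.|].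
    The first one keeps [l] in [Omega] and reads
    [|l - x|^2 <= lambda B(l) (E(x) - E(l))], so [E(x^k)] is nonincreasing and
    converges, both sequences are bounded, and [|l^k - x^k| -> 0]. Accepting
    [t^k] decreases [E] by at least [eps / B(t^k)], which is bounded below, so
    eventually [y^k = l^k] and [|x^k - x^(k+1)| <= 2 |l^k - x^k|]. *)

Import Order.TTheory GRing.Theory Num.Theory.
Import numFieldNormedType.Exports.

Local Open Scope classical_set_scope.
Local Open Scope ring_scope.

(** * Inner product and Euclidean norm on row vectors *)

Section Euclidean.
Context {R : realType} {n : nat}.
Implicit Types (x y z : 'rV[R]_n) (a : R).

Lemma dotC x y : dot x y = dot y x.
Proof. by apply: eq_bigr => i _; rewrite mulrC. Qed.

Lemma dotDl x y z : dot (x + y) z = dot x z + dot y z.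
Proof. by rewrite -big_split; apply: eq_bigr => i _; rewrite mxE mulrDl. Qed.

Lemma dotZl a x y : dot (a *: x) y = a * dot x y.
Proof. by rewrite /dot mulr_sumr; apply: eq_bigr => i _; rewrite mxE mulrA. Qed.

Lemma dotBl x y z : dot (x - y) z = dot x z - dot y z.
Proof. by rewrite dotDl -scaleN1r dotZl mulN1r. Qed.

Lemma dotDr x y z : dot z (x + y) = dot z x + dot z y.
Proof. by rewrite dotC dotDl !(dotC z). Qed.

Lemma dotZr a x y : dot y (a *: x) = a * dot y x.
Proof. by rewrite dotC dotZl (dotC y). Qed.

Lemma dotBr x y z : dot z (x - y) = dot z x - dot z y.
Proof. by rewrite dotC dotBl !(dotC z). Qed.

Lemma dotxx_ge0 x : 0 <= dot x x.
Proof. by apply: sumr_ge0 => i _; rewrite -expr2 sqr_ge0. Qed.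

Lemma enorm_ge0 x : 0 <= enorm x.
Proof. exact: sqrtr_ge0. Qed.

Lemma sqr_enorm x : enorm x ^+ 2 = dot x x.
Proof. by rewrite sqr_sqrtr ?dotxx_ge0. Qed.

Lemma ler_coord_enorm x i : `|x 0 i| <= enorm x.
Proof.
rewrite -sqrtr_sqr ler_wsqrtr // /dot (bigD1 i) //= -expr2 lerDl.
by apply: sumr_ge0 => j _; rewrite -expr2 sqr_ge0.
Qed.

Lemma enorm_eq0 x : enorm x = 0 -> x = 0.
Proof.
move=> x0; apply/rowP => i; rewrite mxE; apply/eqP.
by rewrite -normr_le0 -x0 ler_coord_enorm.
Qed.

Lemma enormZ a x : enorm (a *: x) = `|a| * enorm x.
Proof.
by rewrite /enorm dotZl dotZr mulrA -expr2 sqrtrM ?sqr_ge0 // sqrtr_sqr.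
Qed.

Lemma enormB x y : enorm (x - y) = enorm (y - x).
Proof. by rewrite -opprB -scaleN1r enormZ normrN1 mul1r. Qed.

(** Cauchy-Schwarz: expand [0 <= | |y| x - |x| y |^2] and divide by [2 |x| |y|], the case of a zero
    vector being apart. *)
Lemma ler_dot_enorm x y : dot x y <= enorm x * enorm y.
Proof.
have [x0|x0] := eqVneq (enorm x) 0.
  by rewrite x0 mul0r (enorm_eq0 _ x0) -(scale0r 0) dotZl mul0r.
have [y0|y0] := eqVneq (enorm y) 0.
  by rewrite y0 mulr0 (enorm_eq0 _ y0) -(scale0r 0) dotZr mul0r.
have xy_gt0 : 0 < enorm x * enorm y.
  by rewrite mulr_gt0 // lt0r ?x0 ?y0 enorm_ge0.
have := dotxx_ge0 (enorm y *: x - enorm x *: y).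
rewrite !(dotBl, dotBr, dotZl, dotZr) -!sqr_enorm (dotC y x).
rewrite (_ : _ - _ = 2 * (enorm x * enorm y) *
  (enorm x * enorm y - dot x y)); last by ring.
by rewrite pmulr_rge0 ?subr_ge0 // mulr_gt0.
Qed.

Lemma ler_enormD x y : enorm (x + y) <= enorm x + enorm y.
Proof.
rewrite -ler_sqr ?nnegrE ?addr_ge0 ?enorm_ge0 // sqr_enorm.
rewrite !(dotDl, dotDr) (dotC y x) -!sqr_enorm.
have := ler_dot_enorm x y; nra.
Qed.

(* [z / |z|] is the point of the sphere nearest to [z], whence the factor 2. *)
Lemma enorm_sub_normalize x z : enorm x = 1 -> z != 0 ->
  enorm (x - (enorm z)^-1 *: z) <= 2 * enorm (z - x).
Proof.
move=> x1 z0.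
have z_gt0 : 0 < enorm z.
  by rewrite lt0r enorm_ge0 andbT; apply: contraNneq z0 => /enorm_eq0 ->.
(* The second summand has norm [| |z| - 1 |], which is at most [|z - x|] by the reverse triangle
   inequality, as [|x| = 1]. *)
have -> : x - (enorm z)^-1 *: z = (x - z) + (1 - (enorm z)^-1) *: z.
  by rewrite scalerBl scale1r addrA subrK.
apply: le_trans (ler_enormD _ _) _; rewrite enormZ (enormB x).
rewrite -[X in _ * X]gtr0_norm // -normrM mulrBl mul1r mulVf ?gt_eqF //.
have zx := ler_enormD (z - x) x; rewrite subrK x1 in zx.
have xz := ler_enormD (x - z) z; rewrite subrK x1 enormB in xz.
have : `|enorm z - 1| <= enorm (z - x) by rewrite ler_norml; lra.
lra.
Qed.

End Euclidean.

(** * Sublinear functions: subgradients, proximal points, linear growth *)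

Section Sublinear.
Context {R : realType} {n : nat}.
Implicit Types (f : 'rV[R]_n -> R) (x y z p q v : 'rV[R]_n).

Record sublinear f : Prop := {
  sublin_ge0 : forall x, 0 <= f x;
  sublinZ : forall a x, 0 <= a -> f (a *: x) = a * f x;
  sublinD : forall x y, f (x + y) <= f x + f y
}.

(** Subadditivity is convexity at the midpoint, with the factor 1/2 cleared by homogeneity. *)
Lemma convex_sublinear f :
  convex_function setT f -> pos_homogeneous f -> sublinear f.
Proof.
move=> fconv fhom; have fZ a x : 0 <= a -> f (a *: x) = a * f x.
  by move=> a0; case: (fhom a x a0).
split=> // [x|x y]; first by have [_] := fhom 1 x ler01; rewrite mul1r.
have half0 : 0 <= 2^-1 :> R by rewrite invr_ge0.
have half1 : 2^-1 <= 1 :> R by rewrite invf_le1 ?ler1n.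
have := fconv (Itv01 half0 half1) x y; rewrite !in_setT => /(_ isT isT).
rewrite convRE /= /conv /=.
have -> : unstable.onem 2^-1 = 2^-1 :> R by rewrite /unstable.onem; lra.
by rewrite -scalerDr fZ // -mulrDr ler_pM2l ?invr_gt0.
Qed.

Lemma sublin0 {f} : sublinear f -> f 0 = 0.
Proof. by move=> fS; rewrite -(scale0r 0) (sublinZ _ fS) ?mul0r. Qed.

Lemma sublinear_scale f a : 0 <= a -> sublinear f ->
  sublinear (fun z => a * f z).
Proof.
move=> a0 fS; split=> [x|b x b0|x y].
- by rewrite mulr_ge0 ?(sublin_ge0 _ fS).
- by rewrite (sublinZ _ fS) // mulrCA.
- by rewrite -mulrDr ler_wpM2l ?(sublinD _ fS).
Qed.

(** The subgradient inequality tested at [x + z] gives the bound, by subadditivity; tested at [0] it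
    gives the missing half of the equality. *)
Lemma subdiff_sublinear {f x v} : sublinear f -> subdiff f x v ->
  (forall z, dot v z <= f z) /\ dot v x = f x.
Proof.
move=> fS vx.
have vle z : dot v z <= f z.
  have := vx (x + z); rewrite addrAC subrr add0r.
  move=> /le_trans/(_ (sublinD _ fS x z)).
  by rewrite lerD2l.
split=> //; apply/eqP; rewrite eq_le vle /=.
have := vx 0; rewrite sub0r (sublin0 fS) -scaleN1r dotZr mulN1r.
by rewrite subr_le0.
Qed.

(** First-order optimality: compare [p] with [(1 - s) p + s z], divide by [s], and let [s] tend to
    0. *)
Lemma prox_subdiff {f q p} : sublinear f -> prox f q p -> subdiff f p (q - p).
Proof.
move=> fS pq z.
have step s : 0 < s -> s < 1 ->
    f p + dot (q - p) (z - p) <= f z + s * (2^-1 * enorm (z - p) ^+ 2).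
  move=> s0 s1; have := pq ((1 - s) *: p + s *: z).
  have -> : q - ((1 - s) *: p + s *: z) = (q - p) - s *: (z - p).
    by apply/rowP => i; rewrite !mxE; ring.
  have := sublinD _ fS ((1 - s) *: p) (s *: z).
  rewrite !(sublinZ _ fS) ?(ltW s0) ?subr_ge0 ?(ltW s1) //.
  rewrite !sqr_enorm (dotBl _ _ (_ - s *: _)) (dotBr _ (s *: _)).
  rewrite (dotBr _ (s *: _) (s *: _)) !(dotZl, dotZr) (dotC (z - p)).
  set D := dot (q - p) (z - p); set N := dot (z - p) (z - p).
  move=> h1 h2; rewrite -(ler_pM2l s0).
  lra.
apply/ler_addgt0Pl => e e0.
set N := 2^-1 * enorm (z - p) ^+ 2 in step.
have N0 : 0 <= N by rewrite mulr_ge0 ?invr_ge0 ?exprn_ge0 ?enorm_ge0.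
have d0 : 0 < N + e + 1 by lra.
(* This [s] is below 1 and makes the error term [s * N] at most [e]. *)
have s0 : 0 < e / (N + e + 1) by rewrite divr_gt0.
apply: le_trans (step _ s0 _) _; first by rewrite ltr_pdivrMr //; lra.
rewrite addrC lerD2r mulrAC ler_pdivrMr //; nra.
Qed.

(** Expand [x] in the standard basis. The sign of each coordinate selects [f (e i)] or [f (- e i)],
    so the constant sums both. *)
Lemma sublinear_bounded f : sublinear f ->
  exists2 C, 0 <= C & forall x, f x <= C * enorm x.
Proof.
move=> fS.
pose e i : 'rV[R]_n := delta_mx 0 i.
have fsum (F : 'I_n -> 'rV[R]_n) : f (\sum_i F i) <= \sum_i f (F i).
  elim/big_ind2 : _ => [|a b c d h1 h2|//]; first by rewrite (sublin0 fS).
  exact: le_trans (sublinD _ fS _ _) (lerD h1 h2).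
exists (\sum_i (f (e i) + f (- e i))).
  by apply: sumr_ge0 => i _; rewrite addr_ge0 ?(sublin_ge0 _ fS).
move=> x; rewrite {1}(row_sum_delta x) mulr_suml.
apply: le_trans (fsum _) _; apply: ler_sum => i _.
rewrite mulrC; apply: (@le_trans _ _ (`|x 0 i| * (f (e i) + f (- e i)))).
  have [xi|xi] := lerP 0 (x 0 i).
    by rewrite (ger0_norm xi) (sublinZ _ fS) // ler_wpM2l // lerDl (sublin_ge0 _ fS).
  rewrite -[_ *: _]opprK -scalerN -scaleNr (sublinZ _ fS)
    ?oppr_ge0 ?(ltW xi) //.
  rewrite (ltr0_norm xi).
  by rewrite ler_wpM2l ?oppr_ge0 ?(ltW xi) // lerDr (sublin_ge0 _ fS).
by rewrite ler_wpM2r ?ler_coord_enorm // addr_ge0 ?(sublin_ge0 _ fS).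
Qed.

End Sublinear.

(** * Estimates for a single iteration *)

Section Iteration.
Context {R : realType} {n : nat}.
Context {T B : 'rV[R]_n -> R}.
Implicit Types (x y l t v w : 'rV[R]_n).

(** Here [e] stands for [E(x)]. With [p = x + lambda e v - l], optimality gives
    [<p, x> <= lambda T(x)] and [<p, l> = lambda T(l)]. Subtract, and use [<v, l> <= B(l)] and
    [<v, x> = B(x)]; the terms [lambda T(x)] and [lambda e B(x)] cancel. *)
Lemma prox_l_descent (lambda e : R) x v l :
  sublinear T -> sublinear B -> 0 <= lambda -> 0 <= e -> e * B x = T x ->
  subdiff B x v -> prox (fun z => lambda * T z) (x + (lambda * e) *: v) l ->
  enorm (l - x) ^+ 2 + lambda * T l <= lambda * e * B l.
Proof.
move=> TS BS la0 e0 eB /(subdiff_sublinear BS)[vB vx].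
move=> /(prox_subdiff (sublinear_scale _ _ la0 TS)).
move=> /(subdiff_sublinear (sublinear_scale _ _ la0 TS))[/(_ x)].
have := ler_wpM2l (mulr_ge0 la0 e0) (vB l).
rewrite sqr_enorm !(dotBl, dotBr, dotDl, dotZl) vx (dotC l x) -eB mulrA.
lra.
Qed.

(** Optimality at [t] reads [<(e / rho) w - t, t> = T(t) / rho >= 0], so [|t|^2 <= (e / rho) <w, t>
    <= (e / rho) C |t|]. *)
Lemma prox_t_bound (C rho e : R) w t :
  sublinear T -> sublinear B -> (forall z, B z <= C * enorm z) -> 0 <= C ->
  0 < rho -> 0 <= e -> subdiff B 0 w ->
  prox (fun z => T z / rho) ((e / rho) *: w) t -> enorm t <= e / rho * C.
Proof.
move=> TS BS BC C0 rho0 e0 /(subdiff_sublinear BS)[wB _].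
have -> : (fun z => T z / rho) = (fun z => rho^-1 * T z).
  by apply: funext => z; rewrite mulrC.
have rhoV0 : 0 <= rho^-1 by rewrite invr_ge0 ltW.
have TrS := sublinear_scale _ _ rhoV0 TS.
move=> /(prox_subdiff TrS)/(subdiff_sublinear TrS)[_].
have er0 : 0 <= e / rho by rewrite mulr_ge0.
rewrite dotBl dotZl -sqr_enorm => tt.
have := ler_wpM2l er0 (le_trans (wB t) (BC t)).
have := sublin_ge0 _ TrS t; rewrite -tt => h1 h2.
have [->|t0] := eqVneq (enorm t) 0; first by rewrite mulr_ge0.
have t_gt0 : 0 < enorm t by rewrite lt0r t0 enorm_ge0.
rewrite -(ler_pM2r t_gt0); nra.
Qed.

Lemma E_ge0 x : sublinear T -> sublinear B -> 0 <= E T B x.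
Proof.
by move=> TS BS; rewrite divr_ge0 ?(sublin_ge0 _ TS) ?(sublin_ge0 _ BS).
Qed.

Lemma Omega_gt0 x : sublinear B -> Omega B x -> 0 < B x.
Proof. by move=> BS; rewrite /Omega /= lt0r (sublin_ge0 _ BS) andbT. Qed.

Lemma Omega_neq0 x : sublinear B -> Omega B x -> x != 0.
Proof. by move=> BS; apply: contraNneq => ->; rewrite (sublin0 BS). Qed.

Lemma E_scale (a : R) x : sublinear T -> sublinear B -> 0 < a ->
  E T B (a *: x) = E T B x.
Proof.
move=> TS BS a0; rewrite /E (sublinZ _ TS) ?(sublinZ _ BS) ?(ltW a0) //.
by rewrite -mulf_div divff ?gt_eqF ?mul1r.
Qed.

(** [E] is homogeneous of degree 0, so projecting [y] to the sphere preserves the decrease already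
    obtained. *)
Lemma normalize_sphere_Omega y : sublinear T -> sublinear B -> Omega B y ->
  [/\ enorm ((enorm y)^-1 *: y) = 1, Omega B ((enorm y)^-1 *: y)
    & E T B ((enorm y)^-1 *: y) = E T B y].
Proof.
move=> TS BS yO.
have y_gt0 : 0 < enorm y.
  rewrite lt0r enorm_ge0 andbT; apply: contraNneq (Omega_neq0 _ BS yO).
  by move=> /enorm_eq0 ->.
have yV_gt0 : 0 < (enorm y)^-1 by rewrite invr_gt0.
split; last exact: E_scale.
- by rewrite enormZ gtr0_norm // mulVf ?gt_eqF.
- by rewrite /Omega /= (sublinZ _ BS) ?(ltW yV_gt0) // mulf_neq0 ?gt_eqF //
    (Omega_gt0 _ BS yO).
Qed.

(* If [B l = 0], the descent inequality forces [l = x]. *)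
Lemma prox_l_Omega (lambda : R) x v l :
  sublinear T -> sublinear B -> 0 <= lambda -> Omega B x -> subdiff B x v ->
  prox (fun z => lambda * T z) (x + (lambda * E T B x) *: v) l ->
  Omega B l /\ enorm (l - x) ^+ 2 <= lambda * B l * (E T B x - E T B l).
Proof.
move=> TS BS la0 xO vx pl.
have EB z : Omega B z -> E T B z * B z = T z by move=> zO; rewrite divfK.
have := prox_l_descent _ _ _ _ _ TS BS la0 (E_ge0 x TS BS) (EB x xO) vx pl.
have Tl0 : 0 <= lambda * T l by rewrite mulr_ge0 ?(sublin_ge0 _ TS).
move=> desc.
have lO : Omega B l.
  apply/eqP => Bl0; move: desc; rewrite Bl0 mulr0 => desc.
  have /eqP : enorm (l - x) ^+ 2 = 0.
    by apply/eqP; rewrite eq_le sqr_ge0 andbT; lra.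
  rewrite sqrf_eq0 => /eqP /enorm_eq0 /eqP; rewrite subr_eq0 => /eqP lx.
  by move: xO; rewrite /Omega /= -lx Bl0 eqxx.
split=> //; move: desc; rewrite -{1}(EB l lO); lra.
Qed.

(** As [|x| = 1], expanding the square in the descent inequality gives
    [|l|^2 + 1 <= (2 + lambda E(x) C) |l|]. *)
Lemma prox_l_bound (lambda C : R) x v l :
  sublinear T -> sublinear B -> (forall z, B z <= C * enorm z) -> 0 <= C ->
  0 <= lambda -> enorm x = 1 -> Omega B x -> subdiff B x v ->
  prox (fun z => lambda * T z) (x + (lambda * E T B x) *: v) l ->
  enorm l <= 2 + lambda * E T B x * C.
Proof.
move=> TS BS BC C0 la0 x1 xO vx pl.
have eB : E T B x * B x = T x by rewrite divfK.
have := prox_l_descent _ _ _ _ _ TS BS la0 (E_ge0 x TS BS) eB vx pl.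
have Tl0 : 0 <= lambda * T l by rewrite mulr_ge0 ?(sublin_ge0 _ TS).
have le0 : 0 <= lambda * E T B x by rewrite mulr_ge0 ?E_ge0.
have := ler_wpM2l le0 (BC l).
rewrite sqr_enorm !(dotBl, dotBr) (dotC l x) -!sqr_enorm x1.
have := ler_dot_enorm x l; rewrite x1 mul1r.
have := enorm_ge0 l; set L := enorm l; set K := lambda * E T B x => *.
have K0 : 0 <= K * C by rewrite mulr_ge0.
nra.
Qed.

(* When the test accepts [t], the ratio [E] drops by at least [eps / B t]. *)
Lemma accept_drop (eps rho : R) l t : sublinear T -> sublinear B -> 0 < eps ->
  gtilde T rho t - htilde T B rho l t < - eps ->
  Omega B t /\ eps <= B t * (E T B l - E T B t).
Proof.
move=> TS BS eps0; rewrite /gtilde /htilde => acc.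
have Tt := sublin_ge0 _ TS t.
have tO : Omega B t.
  by apply/eqP => Bt0; move: acc; rewrite Bt0 mulr0; lra.
have EB : E T B t * B t = T t by rewrite divfK.
by split=> //; move: acc; rewrite -EB; lra.
Qed.

End Iteration.

(** * Limits of real sequences, and boundedness in the Euclidean norm *)

Lemma cvg0_sqr_le (R : realType) (u d : nat -> R) (M : R) :
  (forall k, 0 <= u k) -> (forall k, u k ^+ 2 <= M * d k) ->
  d k @[k --> \oo] --> (0 : R) -> u k @[k --> \oo] --> (0 : R).
Proof.
move=> u0 ud d0.
apply: (@squeeze_cvgr _ _ _ _ (fun=> 0) (fun k => Num.sqrt (M * d k))).
- by near=> k; rewrite u0 /= -[u k]ger0_norm // -sqrtr_sqr ler_wsqrtr.
- exact: cvg_cst.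
- have Md0 : M * d k @[k --> \oo] --> (0 : R).
    by rewrite -(mulr0 M); apply: cvgM => //; exact: cvg_cst.
  by have := cvg_comp _ _ Md0 (@sqrt_continuous R 0); rewrite sqrtr0.
Unshelve. all: by end_near. Qed.

(** The sequence converges by monotonicity, and its shift has the same limit. *)
Lemma nonincreasing_diff_cvg0 (R : realType) (e : nat -> R) :
  (forall k, 0 <= e k) -> (forall k, e k.+1 <= e k) ->
  e k - e k.+1 @[k --> \oo] --> (0 : R).
Proof.
move=> e0 edec.
have ecvg : cvgn e.
  apply: nonincreasing_is_cvgn; first exact/nonincreasing_seqP.
  by exists 0 => _ [k _ <-].
rewrite -(subrr (limn e)); apply: cvgB => //.
by have := cvg_shiftS e (nbhs (limn e)) => ->.
Qed.

Lemma bounded_fun_enorm (R : realType) (n : nat) (u : nat -> 'rV[R]_n) (M : R) :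
  (forall k, enorm (u k) <= M) -> bounded_fun (fun k => enorm (u k)).
Proof.
move=> uM; exists M; split; first exact: num_real.
move=> r Mr k _ /=; rewrite ger0_norm ?enorm_ge0 //.
exact: le_trans (uM k) (ltW Mr).
Qed.

Theorem lemma5p2 (R : realType) (n : nat) (T B : 'rV[R]_n -> R)
  (T_convex : convex_function setT T)
  (B_convex : convex_function setT B)
  (T_hom : pos_homogeneous T)
  (B_hom : pos_homogeneous B)
  (ker_TB : [set x | B x = 0] `&` [set x | T x = 0] = [set 0])
  (Omega_nonempty : Omega B !=set0)
  (eps : R) (lambda rho : nat -> R) (v w x l t y : nat -> 'rV[R]_n)
  (run : PS_DCA T B eps lambda rho v w x l t y)
  (lambda_bounds : exists lambda_min lambda_max : R,
    0 < lambda_min /\ lambda_min <= lambda_max /\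
    forall k, lambda_min <= lambda k <= lambda_max)
  (rho_bound : exists rho_min : R,
    0 < rho_min /\ forall k, rho_min <= rho k) :
  [/\ bounded_fun (fun k => enorm (l k)),
      bounded_fun (fun k => enorm (t k)),
      enorm (l k - x k) @[k --> \oo] --> (0 : R)
    & enorm (x k - x k.+1) @[k --> \oo] --> (0 : R)].
Proof.
have TS := convex_sublinear _ T_convex T_hom.
have BS := convex_sublinear _ B_convex B_hom.
have [C C0 BC] := sublinear_bounded _ BS.
case: run => eps0 init la_gt0 vk lk rho_gt0 wk tk yk xk.
case: lambda_bounds => la_min [la_max [la_min0 [_ la_bd]]].
case: rho_bound => rho_min [rho_min0 rho_bd].
have la_ge0 k := ltW (la_gt0 k).
have la_le k : lambda k <= la_max by case/andP: (la_bd k).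
(* Only [Omega B (x k)] is assumed, so that this can drive the induction for [xP]. The final
   alternative separates rejection of [t k] from acceptance. *)
have step k : Omega B (x k) ->
    [/\ Omega B (l k), Omega B (y k), E T B (l k) <= E T B (x k),
        E T B (y k) <= E T B (l k)
      & y k = l k \/ eps <= B (t k) * (E T B (l k) - E T B (y k))].
  move=> xO; have [lO desc] := prox_l_Omega _ _ _ _ TS BS (la_ge0 k) xO
    (vk k) (lk k).
  have lE : E T B (l k) <= E T B (x k).
    rewrite -subr_ge0 -(@pmulr_rge0 _ (lambda k * B (l k))).
      exact: le_trans (sqr_ge0 _) desc.
    by rewrite mulr_gt0 // Omega_gt0.
  rewrite yk; case: ifP => [acc|_]; last by split=> //; left.
  have [tO drop] := accept_drop _ _ _ _ TS BS eps0 acc.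
  split=> //; last by right.
  rewrite -subr_ge0 -(@pmulr_rge0 _ (B (t k))) ?Omega_gt0 //.
  exact: le_trans (ltW eps0) drop.
have xP k : enorm (x k) = 1 /\ Omega B (x k).
  elim: k => [|k [_ xO]]; first by move: init; rewrite inE => -[].
  have [_ yO _ _ _] := step k xO; rewrite xk.
  by have [] := normalize_sphere_Omega _ TS BS yO.
have x1 k : enorm (x k) = 1 by case: (xP k).
have xO k : Omega B (x k) by case: (xP k).
have lO k : Omega B (l k) by case: (step k (xO k)).
have lE k : E T B (l k) <= E T B (x k) by case: (step k (xO k)).
have yE k : E T B (y k) = E T B (x k.+1).
  rewrite xk; have [_ yO _ _ _] := step k (xO k).
  by have [] := normalize_sphere_Omega _ TS BS yO.
have xE k : E T B (x k.+1) <= E T B (l k).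
  by rewrite -yE; case: (step k (xO k)).
have Edec k : E T B (x k.+1) <= E T B (x k) := le_trans (xE k) (lE k).
pose e0 := E T B (x 0%N).
have Ex_le k : E T B (x k) <= e0.
  by elim: k => // k; apply: le_trans (Edec k).
have Ege0 z : 0 <= E T B z by exact: E_ge0.
(* The bound of [prox_l_bound], made uniform by [lambda k <= la_max] and [E (x k) <= e0]. *)
pose L := 2 + la_max * e0 * C.
have lL k : enorm (l k) <= L.
  apply: le_trans (prox_l_bound _ _ _ _ _ TS BS BC C0 (la_ge0 k)
    (x1 k) (xO k) (vk k) (lk k)) _.
  by rewrite lerD2l ler_wpM2r // ler_pM.
(* Likewise for [prox_t_bound], from [E (l k) <= E (x k) <= e0] and [rho_min <= rho k]. *)
pose D := e0 / rho_min * C.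
have tD k : enorm (t k) <= D.
  apply: le_trans (prox_t_bound _ _ _ _ _ TS BS BC C0 (rho_gt0 k) (Ege0 _)
    (wk k) (tk k)) _.
  rewrite ler_wpM2r // ler_pM ?invr_ge0 ?(ltW (rho_gt0 k)) //.
    exact: le_trans (lE k) (Ex_le k).
  by rewrite lef_pV2 ?posrE.
have dcvg := nonincreasing_diff_cvg0 _ (fun k => E T B (x k))
  (fun k => Ege0 _) Edec.
have lxcvg : enorm (l k - x k) @[k --> \oo] --> (0 : R).
  (* The constant dominates [lambda k * B (l k)], and [E (x k) - E (l k)] is at most
     [E (x k) - E (x k.+1)], whose limit is 0. *)
  apply: (cvg0_sqr_le _ _ _ (la_max * (C * L)) _ _ dcvg) => k.
    exact: enorm_ge0.
  have [_ desc] := prox_l_Omega _ _ _ _ TS BS (la_ge0 k) (xO k)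
    (vk k) (lk k).
  apply: le_trans desc _; apply: ler_pM.
  - by rewrite mulr_ge0 ?(sublin_ge0 _ BS).
  - by rewrite subr_ge0.
  - rewrite ler_pM ?(sublin_ge0 _ BS) //.
    by apply: le_trans (BC _) _; rewrite ler_wpM2l.
  - by rewrite lerD2l lerN2.
split=> //.
- exact: bounded_fun_enorm lL.
- exact: bounded_fun_enorm tD.
(* Each acceptance of [t k] costs a fixed amount of the convergent sequence
   [E (x k)], so eventually [y k = l k]. *)
have yl : \forall k \near \oo, y k = l k.
  have dC : C * D * (E T B (x k) - E T B (x k.+1)) @[k --> \oo] --> (0 : R).
    by rewrite -(mulr0 (C * D)); apply: cvgM => //; exact: cvg_cst.
  apply: filterS (cvgr_lt 0 dC _ eps0) => k /= small.
  have [_ _ _ _ [//|drop]] := step k (xO k).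
  (* Since [B (t k) <= C * D] and [E (l k) <= E (x k)], an acceptance would force [eps] below the
     quantity that [small] puts under [eps]. *)
  suff : eps < eps by rewrite ltxx.
  apply: le_lt_trans small; apply: le_trans drop _; rewrite yE.
  apply: ler_pM; rewrite ?(sublin_ge0 _ BS) ?subr_ge0 //.
    by apply: le_trans (BC _) _; rewrite ler_wpM2l.
  by rewrite lerD2r.
(* Once [y k = l k], the next iterate is [l k] normalized, and [enorm_sub_normalize] applies because
   [|x k| = 1]. *)
apply: (@squeeze_cvgr _ _ _ _ (fun=> 0) (fun k => 2 * enorm (l k - x k))).
- apply: filterS yl => k /= ylk; rewrite enorm_ge0 /= xk ylk.
  by rewrite enorm_sub_normalize // (Omega_neq0 _ BS).
- exact: cvg_cst.
- by rewrite -(mulr0 2); apply: cvgM => //; exact: cvg_cst.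
Qed.
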